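(* Let $n\in\mathbb{N}_0$ and $k\in\{-n,\dots,n\}$. Then for all $Q\in\mathrm{SO}(3)$ and $\psi\in[0,\pi]$, \[ \mathcal A Y_n^k (Q,\psi) = \sum_{j=-n}^n \widetilde P_{n}^{j}(0)\, D_n^{j,k}(Q)\, s_j(\psi), \] where $s_0(\psi)=2\psi$ and $s_j(\psi)=\frac{2\sin(j\psi)}{j}$ for $j\neq 0$, and \[ \widetilde P_n^j(0) = \begin{cases} (-1)^{\frac{n+j}{2}} \sqrt{\frac{2n+1}{4\pi} \frac{(n-j-1)!!\,(n+j-1)!!}{(n-j)!!\,(n+j)!!}}, & n+j\text{ even},\\ 0, & n+j\text{ odd}.\end{cases} \]
   Context: $\mathbb S^2=\{\xi\in\mathbb R^3:|\xi|=1\}$ with spherical coordinates $\xi(\varphi,\vartheta)=(\cos\varphi\sin\vartheta,\sin\varphi\sin\vartheta,\cos\vartheta)^\top$. Associated Legendre functions: $P_n^k(t)=\frac{(-1)^k}{2^n n!}(1-t^2)^{k/2}\frac{d^{n+k}}{dt^{n+k}}(t^2-1)^n$ for $k=0,\dots,n$; normalized: $\widetilde P_n^k=\sqrt{\frac{2n+1}{4\pi}\frac{(n-k)!}{(n+k)!}}\,P_n^k$ and $\widetilde P_n^{-k}=(-1)^k\widetilde P_n^k$. Spherical harmonics: $Y_n^k(\xi(\varphi,\vartheta))=\widetilde P_n^k(\cos\vartheta)e^{ik\varphi}$, $n\in\mathbb N_0$, $k=-n,\dots,n$. Rotations are parametrized by Euler angles (zyz convention) $Q(\alpha,\beta,\gamma)=R_3(\alpha)R_2(\beta)R_3(\gamma)$,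 where $R_3(\alpha)$ is the rotation by angle $\alpha$ about the third coordinate axis (matrix rows $(\cos\alpha,-\sin\alpha,0),(\sin\alpha,\cos\alpha,0),(0,0,1)$) and $R_2(\beta)$ the rotation about the second axis (rows $(\cos\beta,0,\sin\beta),(0,1,0),(-\sin\beta,0,\cos\beta)$). Wigner D-functions: $D_n^{k,j}(Q(\alpha,\beta,\gamma))=e^{-ik\alpha}d_n^{k,j}(\cos\beta)e^{-ij\gamma}$ with $d_n^{k,j}(t)=\frac{(-1)^{n-j}}{2^n}\sqrt{\frac{(n+k)!(1-t)^{j-k}}{(n-j)!(n+j)!(n-k)!(1+t)^{j+k}}}\left(\frac{d}{dt}\right)^{n-k}\left[(1+t)^{n+j}(1-t)^{n-j}\right]$. For $\varphi\in\mathbb R$ let $e_\varphi=(\cos\varphi,\sin\varphi,0)^\top$. The arc transform of $f\in C(\mathbb S^2)$ is $\mathcal Af(Q,\psi)=\int_{-\psi}^{\psi} f(Q^{-1}e_\varphi)\,d\varphi$ for $Q\in\mathrm{SO}(3)$, $\psi\in[0,\pi]$ (the integral of $f$ over the great circle arc of length $2\psi$ mapped by $Q$ to the equatorial arc centered at $(1,0,0)^\top$). Double factorials: $n!!=n(n-2)\cdots$ down to $2$ or $1$, with $0!!=(-1)!!=1$. *)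

(* Defs.v *)
From Stdlib Require Import Reals ZArith Lra.
From Coquelicot Require Import Coquelicot.
Open Scope R_scope.

Definition vec3 : Type := (R * R * R)%type.
Definition vx (v : vec3) : R := fst (fst v).
Definition vy (v : vec3) : R := snd (fst v).
Definition vz (v : vec3) : R := snd v.

Definition Czpow (u : C) (k : Z) : C :=
  match k with
  | Z0 => 1%C
  | Zpos p => Cpow u (Pos.to_nat p)
  | Zneg p => Cpow (Cinv u) (Pos.to_nat p)
  end.

Definition cis (x : R) : C := (cos x, sin x).

Definition Pleg (n k : nat) (t : R) : R :=
  (-1) ^ k / (2 ^ n * INR (fact n)) * sqrt (1 - t ^ 2) ^ k
  * Derive_n (fun s => (s ^ 2 - 1) ^ n) (n + k) t.

Definition Ptil_nat (n k : nat) (t : R) : R :=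
  sqrt ((2 * INR n + 1) / (4 * PI) * (INR (fact (n - k)) / INR (fact (n + k))))
  * Pleg n k t.
Definition Ptil (n : nat) (k : Z) (t : R) : R :=
  if (0 <=? k)%Z then Ptil_nat n (Z.to_nat k) t
  else (-1) ^ (Z.to_nat (- k)) * Ptil_nat n (Z.to_nat (- k)) t.

(* e^{i phi} for a point xi = xi(phi, theta) of the sphere: (x1 + i x2)/sin theta.
   At the poles (x1 = x2 = 0) phi is arbitrary; we take phi = 0 there (the value
   of Y_n^k there does not depend on this choice since tilde P_n^k(+-1) = 0, k<>0). *)
Definition eiphi (v : vec3) : C :=
  let r := sqrt (vx v ^ 2 + vy v ^ 2) in
  if Req_EM_T r 0 then 1%C else (vx v / r, vy v / r).

(* Spherical harmonic Y_n^k as a function on S^2: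
   Y_n^k(xi(phi,theta)) = tilde P_n^k(cos theta) e^{i k phi}, cos theta = x3 *)
Definition Ysh (n : nat) (k : Z) (v : vec3) : C :=
  RtoC (Ptil n k (vz v)) * Czpow (eiphi v) k.

Definition rot3 (a : R) (v : vec3) : vec3 :=
  (cos a * vx v - sin a * vy v, sin a * vx v + cos a * vy v, vz v).
Definition rot2 (b : R) (v : vec3) : vec3 :=
  (cos b * vx v + sin b * vz v, vy v, - sin b * vx v + cos b * vz v).

Definition Qrot (a b c : R) (v : vec3) : vec3 := rot3 a (rot2 b (rot3 c v)).
Definition Qinv (a b c : R) (v : vec3) : vec3 := rot3 (- c) (rot2 (- b) (rot3 (- a) v)).

Definition e_phi (phi : R) : vec3 := (cos phi, sin phi, 0).

Definition arc (f : vec3 -> C) (a b c psi : R) : C :=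
  RInt (V := C_R_CompleteNormedModule) (fun phi => f (Qinv a b c (e_phi phi))) (- psi) psi.

Definition zfact (z : Z) : R := INR (fact (Z.to_nat z)).

(* Wigner small d-function d_n^{k,j}(t), literal formula (valid for -1 < t < 1) *)
Definition wd (n : nat) (k j : Z) (t : R) : R :=
  (-1) ^ (Z.to_nat (Z.of_nat n - j)) / 2 ^ n
  * sqrt (zfact (Z.of_nat n + k) * powerRZ (1 - t) (j - k)
          / (zfact (Z.of_nat n - j) * zfact (Z.of_nat n + j) * zfact (Z.of_nat n - k)
             * powerRZ (1 + t) (j + k)))
  * Derive_n (fun s => (1 + s) ^ (Z.to_nat (Z.of_nat n + j)) * (1 - s) ^ (Z.to_nat (Z.of_nat n - j)))
             (Z.to_nat (Z.of_nat n - k)) t.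

(* d_n^{k,j}(cos b) for b in [0,pi]; at b = 0, pi (t = +-1) the formula is
   extended by continuity. *)
Definition wd_beta (n : nat) (k j : Z) (b : R) : R :=
  if Rlt_dec 0 b then
    if Rlt_dec b PI then wd n k j (cos b)
    else real (Lim (fun x => wd n k j (cos x)) b)
  else real (Lim (fun x => wd n k j (cos x)) b).

Definition WD (n : nat) (k j : Z) (a b c : R) : C :=
  cis (- IZR k * a) * RtoC (wd_beta n k j b) * cis (- IZR j * c).

Definition sfun (j : Z) (psi : R) : R :=
  if Z.eqb j 0 then 2 * psi else 2 * sin (IZR j * psi) / IZR j.

(* double factorial on integers: z!! = z (z-2) ..., with z!! = 1 for z <= 0 *)
Fixpoint dfact_nat (m : nat) : nat :=
  match m with
  | O => 1%nat
  | S O => 1%nat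
  | S ((S p) as q) => (m * dfact_nat p)%nat
  end.
Definition dfact (z : Z) : R := INR (dfact_nat (Z.to_nat z)).

(* Main.v *)
Require Import Defs.
From Stdlib Require Import Reals ZArith Lra Lia.
From Coquelicot Require Import Coquelicot.
Open Scope R_scope.

(* The harmonics of degree n are the coefficients of a power of a linear form in
   the point: with X = x + iy, Y = x - iy,
     (- Y v^2 + 2 z u v + X u^2)^n = sum_m a_m Y_n^(m-n)(x,y,z) u^m v^(2n-m),
   by Taylor expansion of the Rodrigues formula.  Likewise d_n^(n-m,l-n)(cos b) is,
   up to an explicit factor, the coefficient of w^m in (p + q w)^l (p w - q)^(2n-l)
   with p = sqrt (1 + cos b), q = sqrt (1 - cos b).  A rotation about the second axis
   acts on the first generating function by the Moebius substitution u = q + p w,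
   v = p - q w, so comparing coefficients gives the addition formula
   Y_n^k(Q^-1 xi) = sum_j D_n^(j,k)(Q) Y_n^j(xi) for xi on the equator, where
   Y_n^j(e_phi) = P_n^j(0) e^(i j phi); it remains to integrate termwise in phi.
   The value P_n^j(0) is read off the generating function (u^2 - v^2)^n at e_0. *)

(** * Coefficients of products of linear forms *)

Definition csum (f : nat -> C) (N : nat) : C := sum_n (G := C_AbelianMonoid) f N.
Definition rsum (f : nat -> R) (N : nat) : R := sum_n (G := R_AbelianMonoid) f N.

Lemma rsum_0 (f : nat -> R) : rsum f 0 = f O.
Proof. exact (sum_O f). Qed.

Lemma rsum_S (f : nat -> R) N : rsum f (S N) = rsum f N + f (S N).
Proof. exact (sum_Sn f N). Qed.

Lemma rsum_ext (f g : nat -> R) N :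
  (forall m, (m <= N)%nat -> f m = g m) -> rsum f N = rsum g N.
Proof. exact (sum_n_ext_loc f g N). Qed.

Lemma csum_ext (f g : nat -> C) N :
  (forall m, (m <= N)%nat -> f m = g m) -> csum f N = csum g N.
Proof. exact (sum_n_ext_loc f g N). Qed.

Lemma csum_0 (f : nat -> C) : csum f 0 = f O.
Proof. exact (sum_O f). Qed.

Lemma csum_S (f : nat -> C) N : csum f (S N) = (csum f N + f (S N))%C.
Proof. exact (sum_Sn f N). Qed.

Lemma csum_S_first (f : nat -> C) N :
  csum f (S N) = (f O + csum (fun m => f (S m)) N)%C.
Proof.
  induction N as [|N IH].
  - now rewrite csum_S, !csum_0.
  - rewrite csum_S, IH, csum_S. ring.
Qed.

Lemma csum_scal (a : C) (f : nat -> C) N :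
  csum (fun m => (a * f m)%C) N = (a * csum f N)%C.
Proof. exact (sum_n_mult_l a f N). Qed.

Lemma csum_plus (f g : nat -> C) N :
  csum (fun m => (f m + g m)%C) N = (csum f N + csum g N)%C.
Proof. exact (sum_n_plus f g N). Qed.

Lemma csum_single (f : nat -> C) N k : (k <= N)%nat ->
  (forall m, (m <= N)%nat -> m <> k -> f m = RtoC 0) -> csum f N = f k.
Proof.
  revert k. induction N as [|N IH]; intros k Hk Hf.
  - rewrite csum_0. now replace k with O by lia.
  - rewrite csum_S. destruct (Nat.eq_dec k (S N)) as [->|Hn].
    + assert (H : forall M, (M <= N)%nat -> csum f M = RtoC 0).
      { induction M as [|M IHM]; intros HM.
        - rewrite csum_0. apply Hf; lia.
        - rewrite csum_S, IHM, (Hf (S M)) by lia. ring. }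
      rewrite H by lia. ring.
    + rewrite (IH k), (Hf (S N)); [ring|lia|lia|lia|]. intros; apply Hf; lia.
Qed.

Lemma Re_csum (f : nat -> C) N : Re (csum f N) = rsum (fun m => Re (f m)) N.
Proof.
  induction N as [|N IH].
  - now rewrite csum_0, rsum_0.
  - rewrite csum_S, rsum_S, <- IH. reflexivity.
Qed.

Lemma Im_csum (f : nat -> C) N : Im (csum f N) = rsum (fun m => Im (f m)) N.
Proof.
  induction N as [|N IH].
  - now rewrite csum_0, rsum_0.
  - rewrite csum_S, rsum_S, <- IH. reflexivity.
Qed.

Lemma csum_rev (f : nat -> C) N : csum f N = csum (fun m => f (N - m)%nat) N.
Proof.
  revert f. induction N as [|N IH]; intros f.
  - now rewrite !csum_0.
  - rewrite csum_S_first, csum_S, (IH (fun m => f (S m))), Nat.sub_diag.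
    rewrite Cplus_comm. f_equal. apply csum_ext. intros m Hm.
    f_equal. lia.
Qed.

Lemma csum_switch (f : nat -> nat -> C) M N :
  csum (fun i => csum (fun j => f i j) N) M = csum (fun j => csum (fun i => f i j) M) N.
Proof. exact (sum_n_switch f M N). Qed.

(** * Recovering the coefficients of a polynomial from its values *)

Lemma Derive_n_poly (c : nat -> R) N m : (m <= N)%nat ->
  Derive_n (fun h => rsum (fun i => c i * h ^ i) N) m 0 = c m * INR (fact m).
Proof.
  intros Hm. unfold rsum. rewrite (Derive_n_sum_n N (fun i h => c i * h ^ i)).
  2:{ exists posreal_one. intros t _ l j _ _.
      apply ex_derive_n_scal_l.
      eapply ex_derive_n_ext. 2: apply (ex_derive_n_pow j l t). reflexivity. }
  (* The sum of derivatives is moved to [C] so that [csum_single] can isolate the term of index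
     [m]. *)
  apply RtoC_inj. transitivity (csum (fun j => RtoC (Derive_n (fun h => c j * h ^ j) m 0)) N).
  { induction N as [|N IH] in |- *; [now rewrite csum_0, rsum_0|].
    now rewrite csum_S, rsum_S, <- IH, <- RtoC_plus. }
  rewrite (csum_single _ N m Hm).
  - f_equal. rewrite Derive_n_scal_l, Derive_n_pow_smalli by lia.
    rewrite Nat.sub_diag. simpl. field.
  - intros i Hi Him. f_equal. rewrite Derive_n_scal_l.
    destruct (le_lt_dec m i) as [H|H].
    + rewrite Derive_n_pow_smalli, pow_i by lia. ring.
    + rewrite Derive_n_pow_bigi by lia. ring.
Qed.

Lemma rpoly_coef_unique (c d : nat -> R) N :
  (forall h, rsum (fun i => c i * h ^ i) N = rsum (fun i => d i * h ^ i) N) ->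
  forall m, (m <= N)%nat -> c m = d m.
Proof.
  intros H m Hm. apply Rmult_eq_reg_r with (INR (fact m)); [|apply INR_fact_neq_0].
  rewrite <- !(Derive_n_poly _ N m Hm). now apply Derive_n_ext.
Qed.

(** For real [h] the real and imaginary parts of the sums are real polynomials in [h], so agreement
    on the real line suffices. Every later comparison of generating functions ends here, with the
    second variable set to 1. *)
Lemma cpoly_coef_unique (c d : nat -> C) N :
  (forall h : R, csum (fun i => c i * RtoC h ^ i)%C N = csum (fun i => d i * RtoC h ^ i)%C N) ->
  forall m, (m <= N)%nat -> c m = d m.
Proof.
  intros H m Hm.
  apply injective_projections; [change (Re (c m) = Re (d m))|change (Im (c m) = Im (d m))].
  - apply (rpoly_coef_unique (fun m => Re (c m)) (fun m => Re (d m)) N); trivial. intros h.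
    etransitivity; [|etransitivity; [exact (f_equal Re (H h))|]]; rewrite Re_csum;
      apply rsum_ext; intros i _; now rewrite <- RtoC_pow, re_scal_r.
  - apply (rpoly_coef_unique (fun m => Im (c m)) (fun m => Im (d m)) N); trivial. intros h.
    etransitivity; [|etransitivity; [exact (f_equal Im (H h))|]]; rewrite Im_csum;
      apply rsum_ext; intros i _; now rewrite <- RtoC_pow, im_scal_r.
Qed.

Definition coef_one (m : nat) : R := match m with O => 1 | S _ => 0 end.

Definition coef_mul_lin (al be : R) (c : nat -> R) (m : nat) : R :=
  al * c m + be * match m with O => 0 | S m' => c m' end.

(* [linprod al be i ga de j m] is the coefficient of [u^m v^(i+j-m)] in
   [(al v + be u)^i (ga v + de u)^j]. *)
Definition linprod (al be : R) (i : nat) (ga de : R) (j : nat) : nat -> R :=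
  Nat.iter i (coef_mul_lin al be) (Nat.iter j (coef_mul_lin ga de) coef_one).

(** The vanishing beyond the degree is carried through the same induction as the identity: it
    removes the top term when the new linear factor contributes [al * v], while [be * u] shifts the
    index by one. *)
Lemma coef_mul_lin_iter_sum (al be : R) (c : nat -> R) N i (u v : C) :
  (forall m, (N < m)%nat -> c m = 0) ->
  (forall m, (i + N < m)%nat -> Nat.iter i (coef_mul_lin al be) c m = 0) /\
  csum (fun m => RtoC (Nat.iter i (coef_mul_lin al be) c m) * u ^ m * v ^ (i + N - m))%C (i + N)
  = ((al * v + be * u) ^ i * csum (fun m => RtoC (c m) * u ^ m * v ^ (N - m)) N)%C.
Proof.
  intros Hc. induction i as [|i [Hs IH]].
  - split; [exact Hc|]. simpl. now rewrite Cmult_1_l.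
  - simpl Nat.iter. simpl Nat.add. set (d := Nat.iter i _ c) in *. split.
    + intros m Hm. unfold coef_mul_lin. destruct m as [|m]; [lia|].
      rewrite !Hs by lia. ring.
    + rewrite Cpow_S, <- Cmult_assoc, <- IH. set (K := (i + N)%nat) in *.
      transitivity (csum (fun m => RtoC (al * d m) * u ^ m * v ^ (S K - m))%C (S K) +
        csum (fun m => RtoC (be * match m with O => 0 | S m' => d m' end)
                         * u ^ m * v ^ (S K - m))%C (S K))%C.
      { rewrite <- csum_plus. apply csum_ext. intros m _. unfold coef_mul_lin.
        rewrite RtoC_plus. ring. }
      rewrite Cmult_plus_distr_r. f_equal.
      * rewrite csum_S, Hs, Rmult_0_r, <- csum_scal by lia.
        rewrite !Cmult_0_l, Cplus_0_r. apply csum_ext. intros m Hm.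
        rewrite Nat.sub_succ_l, Cpow_S, RtoC_mult by lia. ring.
      * rewrite csum_S_first, Rmult_0_r, <- csum_scal, !Cmult_0_l, Cplus_0_l.
        apply csum_ext. intros m _. rewrite Nat.sub_succ, Cpow_S, RtoC_mult. ring.
Qed.

Lemma linprod_sum (al be : R) i (ga de : R) j (u v : C) :
  csum (fun m => RtoC (linprod al be i ga de j m) * u ^ m * v ^ (i + j - m))%C (i + j)
  = ((al * v + be * u) ^ i * (ga * v + de * u) ^ j)%C.
Proof.
  destruct (coef_mul_lin_iter_sum ga de coef_one 0 j u v) as [H1 H2].
  { intros [|m] Hm; [lia|reflexivity]. }
  rewrite Nat.add_0_r in H1, H2.
  destruct (coef_mul_lin_iter_sum al be _ j i u v H1) as [_ H3].
  unfold linprod. rewrite H3, H2, csum_0. simpl. ring.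
Qed.

Lemma rsum_RtoC (f : nat -> R) N : RtoC (rsum f N) = csum (fun m => RtoC (f m)) N.
Proof.
  induction N as [|N IH]; [now rewrite csum_0, rsum_0|].
  now rewrite csum_S, rsum_S, <- IH, <- RtoC_plus.
Qed.

Lemma linprod_rsum (al be : R) i (ga de : R) j (h : R) :
  rsum (fun m => linprod al be i ga de j m * h ^ m) (i + j)
  = (al + be * h) ^ i * (ga + de * h) ^ j.
Proof.
  apply RtoC_inj. rewrite rsum_RtoC, RtoC_mult, !RtoC_pow, !RtoC_plus, !RtoC_mult.
  rewrite <- (Cmult_1_r al), <- (Cmult_1_r ga), <- linprod_sum.
  apply csum_ext. intros m _. rewrite Cpow_1_l, RtoC_mult, RtoC_pow. ring.
Qed.

(** A product of linear factors re-expanded around [t] has its Taylor coefficients at [t] in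
    [linprod]. Both Rodrigues-type formulas, for [Pleg] and for [wd], are evaluated this way. *)
Lemma Derive_n_linprod (f : R -> R) (t al be : R) i (ga de : R) j m :
  (forall h, f (h + t) = (al + be * h) ^ i * (ga + de * h) ^ j) -> (m <= i + j)%nat ->
  Derive_n f m t = linprod al be i ga de j m * INR (fact m).
Proof.
  intros Hf Hm. rewrite <- (Rplus_0_l t) at 1. rewrite <- Derive_n_comp_trans.
  rewrite <- (Derive_n_poly _ (i + j) m Hm). apply Derive_n_ext. intros h.
  now rewrite linprod_rsum.
Qed.

Lemma linprod_continuous (al be ga de : R -> R) i j m x :
  continuous al x -> continuous be x -> continuous ga x -> continuous de x ->
  continuous (fun y => linprod (al y) (be y) i (ga y) (de y) j m) x.
Proof.
  intros Ha Hb Hg Hd. unfold linprod.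
  assert (K : forall (al be : R -> R) (c : R -> nat -> R) i,
     continuous al x -> continuous be x -> (forall m, continuous (fun y => c y m) x) ->
     forall m, continuous (fun y => Nat.iter i (coef_mul_lin (al y) (be y)) (c y) m) x).
  { clear. intros al be c i Ha Hb Hc. induction i as [|i IH]; [exact Hc|].
    intros m. simpl. unfold coef_mul_lin.
    apply (continuous_plus (fun y => al y * _) (fun y => be y * _)).
    - now apply (continuous_mult al).
    - apply (continuous_mult be); trivial. destruct m as [|m]; [apply continuous_const|apply IH]. }
  apply (K al be (fun y => Nat.iter j (coef_mul_lin (ga y) (de y)) coef_one)); trivial.
  intros m'. apply (K ga de (fun _ => coef_one)); trivial. intros; apply continuous_const.
Qed.

(** * Generating function of the spherical harmonics *)

Lemma Cmult_eq_reg_l (a x y : C) : a <> 0 -> (a * x = a * y)%C -> x = y.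
Proof.
  intros Ha H. transitivity (/ a * (a * x))%C; [now field|]. rewrite H. now field.
Qed.

Lemma coef_mul_lin_iter_low (al be : R) (c : nat -> R) k i :
  (forall m, (m < k)%nat -> c m = 0) ->
  (forall m, (m < k)%nat -> Nat.iter i (coef_mul_lin al be) c m = 0) /\
  Nat.iter i (coef_mul_lin al be) c k = al ^ i * c k.
Proof.
  intros Hc. induction i as [|i [IH1 IH2]]; simpl; [split; [exact Hc|ring]|].
  split; [intros m Hm|]; unfold coef_mul_lin at 1.
  - rewrite IH1 by lia. destruct m; [|rewrite IH1 by lia]; ring.
  - rewrite IH2. destruct k; [|rewrite IH1 by lia]; ring.
Qed.

Lemma coef_mul_lin_iter_shift (c : nat -> R) i m :
  Nat.iter i (coef_mul_lin 0 1) c m = if (i <=? m)%nat then c (m - i)%nat else 0.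
Proof.
  revert m. induction i as [|i IH]; intros m.
  - simpl. now rewrite Nat.sub_0_r.
  - simpl Nat.iter. unfold coef_mul_lin at 1. destruct m as [|m]; simpl; [ring|].
    rewrite (IH m). ring.
Qed.

(* Taylor coefficients of [(s^2 - 1)^n] at [t]. *)
Definition legc (n : nat) (t : R) : nat -> R := linprod (t - 1) 1 n (t + 1) 1 n.

Lemma legc_sum n (t : R) (u v : C) :
  csum (fun m => RtoC (legc n t m) * u ^ m * v ^ (2 * n - m))%C (2 * n)
  = (((t * t - 1) * (v * v) + 2 * t * u * v + u * u) ^ n)%C.
Proof.
  unfold legc. replace (2 * n)%nat with (n + n)%nat by lia.
  rewrite linprod_sum, <- Cpow_mult_l. f_equal. rewrite RtoC_minus, RtoC_plus. ring.
Qed.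

Lemma legc_Derive n t m : (m <= 2 * n)%nat ->
  Derive_n (fun s => (s ^ 2 - 1) ^ n) m t = legc n t m * INR (fact m).
Proof.
  intros Hm. apply Derive_n_linprod; [|lia]. intros h.
  rewrite <- Rpow_mult_distr. f_equal. ring.
Qed.

(** At a pole one of the two factors [t - 1 + h], [t + 1 + h] is [h] itself, so the product vanishes
    to order [n]; the constant term [2 * t] of the other factor gives the first nonzero
    coefficient. *)
Lemma legc_pole n t : t * t = 1 ->
  (forall m, (m < n)%nat -> legc n t m = 0) /\ legc n t n = (2 * t) ^ n.
Proof.
  intros Ht. unfold legc, linprod.
  assert (H : t = 1 \/ t = -1).
  { destruct (Rmult_integral (t - 1) (t + 1)); [nra|left|right]; lra. }
  destruct H as [-> | ->].
  - replace (1 - 1) with 0 by ring.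
    split; [intros m Hm|]; rewrite coef_mul_lin_iter_shift.
    + now rewrite (proj2 (Nat.leb_gt n m)).
    + rewrite Nat.leb_refl, Nat.sub_diag.
      rewrite (proj2 (coef_mul_lin_iter_low (1 + 1) 1 coef_one 0 n
        (fun m Hm => False_ind _ (Nat.nlt_0_r m Hm)))).
      simpl. rewrite Rmult_1_r. f_equal. ring.
  - replace (-1 + 1) with 0 by ring.
    destruct (coef_mul_lin_iter_low (-1 - 1) 1
      (Nat.iter n (coef_mul_lin 0 1) coef_one) n n) as [H1 H2].
    { intros m Hm. now rewrite coef_mul_lin_iter_shift, (proj2 (Nat.leb_gt n m)). }
    split; [exact H1|]. rewrite H2, coef_mul_lin_iter_shift, Nat.leb_refl, Nat.sub_diag.
    simpl. rewrite Rmult_1_r. f_equal. ring.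
Qed.

(** This is the relation between the orders [k] and [-k]. With [r = t * t - 1], the form
    [r v^2 + 2 t u v + u^2] is multiplied by [r] under the substitution of [r v] for [u] and [u] for
    [v], which also reverses the order of the coefficients. *)
Lemma legc_sym n t m : (m <= n)%nat ->
  legc n t m = (t * t - 1) ^ (n - m) * legc n t (2 * n - m).
Proof.
  (* The comparison ends by cancelling [r ^ n], so the poles, where [r] is 0, are treated
     separately. *)
  intros Hm. destruct (Req_dec (t * t) 1) as [Ht|Ht].
  - destruct (Nat.eq_dec m n) as [->|Hn].
    + rewrite Nat.sub_diag. replace (2 * n - n)%nat with n by lia. simpl. ring.
    + rewrite (proj1 (legc_pole n t Ht)) by lia.
      replace (t * t - 1) with 0 by lra. rewrite pow_i by lia. ring.
  - set (r := t * t - 1). assert (Hr : r <> 0) by (unfold r; lra).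
    assert (K : (RtoC (r ^ (2 * n - m)) * RtoC (legc n t (2 * n - m))
                 = RtoC (r ^ n) * RtoC (legc n t m))%C).
    { apply (cpoly_coef_unique
        (fun m => RtoC (r ^ (2 * n - m)) * RtoC (legc n t (2 * n - m)))%C
        (fun m => RtoC (r ^ n) * RtoC (legc n t m))%C (2 * n)); [|lia].
      intros h.
      transitivity (RtoC (r ^ n) * csum (fun m => RtoC (legc n t m) * RtoC h ^ m
                                           * 1 ^ (2 * n - m)) (2 * n))%C.
      - rewrite legc_sum, RtoC_pow, <- Cpow_mult_l.
        transitivity (csum (fun m => RtoC (legc n t m) * RtoC r ^ m
                                           * RtoC h ^ (2 * n - m)) (2 * n))%C.
        + rewrite (csum_rev (fun m => RtoC (legc n t m) * RtoC r ^ m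
                                           * RtoC h ^ (2 * n - m))%C).
          apply csum_ext. intros i Hi.
          replace (2 * n - (2 * n - i))%nat with i by lia. rewrite RtoC_pow. ring.
        + rewrite legc_sum. f_equal. unfold r. rewrite RtoC_minus, RtoC_mult. ring.
      - rewrite <- csum_scal. apply csum_ext. intros i _. rewrite Cpow_1_l. ring. }
    rewrite <- !RtoC_mult in K. apply RtoC_inj in K.
    replace (2 * n - m)%nat with (n + (n - m))%nat in K at 1 by lia.
    rewrite pow_add in K. apply Rmult_eq_reg_l with (r ^ n); [|now apply pow_nonzero].
    lra.
Qed.

(* With [X = x + iy], [Y = x - iy] and [t = z] these are, up to normalisation,
   the harmonics [Y_n^(m-n)]; the formula makes sense at the poles. *)
Definition harm (n : nat) (X Y : C) (t : R) (m : nat) : C :=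
  if (n <=? m)%nat then (X ^ (m - n) * legc n t m)%C
  else ((- Y) ^ (n - m) * legc n t (2 * n - m))%C.

(** Away from the poles, multiplication by [X ^ n] turns the sum into that of [legc] at [X * u]: for
    [m < n], [legc_sym] supplies the power of [t * t - 1 = - X * Y] that is needed. At a pole only
    the term [m = n] survives, and [legc_pole] gives its value. *)
Lemma harm_sum n (X Y : C) (t : R) (u v : C) :
  (X * Y = 1 - t * t)%C -> (X = 0 -> Y = 0)%C ->
  csum (fun m => harm n X Y t m * u ^ m * v ^ (2 * n - m))%C (2 * n)
  = ((- Y * (v * v) + 2 * t * u * v + X * (u * u)) ^ n)%C.
Proof.
  intros HXY HX0. destruct (Ceq_dec X 0) as [HX|HX].
  - assert (HY := HX0 HX). subst X Y.
    assert (Ht : t * t = 1).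
    { apply RtoC_inj. rewrite RtoC_mult. rewrite Cmult_0_l in HXY.
      apply Ceq_minus. transitivity (- (1 - t * t))%C; [ring|]. rewrite <- HXY. ring. }
    rewrite (csum_single _ _ n); [|lia|].
    2:{ intros m Hm Hmn. unfold harm. destruct (Nat.leb_spec n m) as [H|H].
        - replace (m - n)%nat with (S (m - S n)) by lia. rewrite Cpow_S. ring.
        - replace (n - m)%nat with (S (n - S m)) by lia. rewrite Cpow_S. ring. }
    unfold harm. rewrite Nat.leb_refl, Nat.sub_diag, (proj2 (legc_pole n t Ht)).
    replace (2 * n - n)%nat with n by lia.
    rewrite RtoC_pow, RtoC_mult. change (0 ^ 0)%C with (RtoC 1).
    rewrite Cmult_1_l, <- !Cpow_mult_l. f_equal. ring.
  - assert (HXn := Cpow_nz X n HX).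
    apply (Cmult_eq_reg_l (X ^ n)%C); [exact HXn|].
    rewrite <- Cpow_mult_l, <- csum_scal.
    transitivity (csum (fun m => RtoC (legc n t m) * (X * u) ^ m * v ^ (2 * n - m))%C (2 * n)).
    + apply csum_ext. intros m Hm. rewrite Cpow_mult_l.
      transitivity (X ^ n * harm n X Y t m * (u ^ m * v ^ (2 * n - m)))%C; [ring|].
      transitivity (X ^ m * legc n t m * (u ^ m * v ^ (2 * n - m)))%C; [|ring].
      f_equal. unfold harm. destruct (Nat.leb_spec n m) as [H|H].
      * replace m with (n + (m - n))%nat at 3 by lia. rewrite Cpow_add_r. ring.
      * rewrite (legc_sym n t m) by lia.
        replace n with (m + (n - m))%nat at 1 by lia.
        rewrite Cpow_add_r, RtoC_mult, RtoC_pow.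
        transitivity (X ^ m * ((X * - Y) ^ (n - m)) * legc n t (2 * n - m))%C;
          [rewrite Cpow_mult_l; ring|].
        replace (X * - Y)%C with (RtoC (t * t - 1)); [ring|].
        rewrite RtoC_minus, RtoC_mult. transitivity (- (1 - t * t))%C; [ring|].
        rewrite <- HXY. ring.
    + rewrite legc_sum. f_equal.
      transitivity (- (1 - t * t) * (v * v) + 2 * t * (X * u) * v + X * u * (X * u))%C;
        [ring|]. rewrite <- HXY. ring.
Qed.

(** The factor [a_m] of the generating function. It depends only on the distance from [m] to [n]:
    the sign that distinguishes the orders [k] and [-k] is carried by the [- Y] in [harm]. *)
Definition nrm (n m : nat) : R :=
  (-1) ^ (n + m) * (2 ^ n * INR (fact n))
  / (sqrt ((2 * INR n + 1) / (4 * PI)) * sqrt (INR (fact m) * INR (fact (2 * n - m)))).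

Lemma sqrt_normalisation_pos n : 0 < (2 * INR n + 1) / (4 * PI).
Proof.
  assert (H := PI_RGT_0). assert (H' := pos_INR n). apply Rdiv_lt_0_compat; lra.
Qed.

Lemma pow_m1_sqr k : (-1) ^ k * (-1) ^ k = 1.
Proof. rewrite <- Rpow_mult_distr. replace (-1 * -1) with 1 by ring. apply pow1. Qed.

Lemma nrm_neq_0 n m : nrm n m <> 0.
Proof.
  unfold nrm.
  assert (H1 := sqrt_lt_R0 _ (sqrt_normalisation_pos n)).
  assert (H2 : 0 < sqrt (INR (fact m) * INR (fact (2 * n - m)))).
  { apply sqrt_lt_R0, Rmult_lt_0_compat; apply INR_fact_lt_0. }
  assert (H3 : (-1) ^ (n + m) <> 0) by (apply pow_nonzero; lra).
  assert (H4 : 2 ^ n <> 0) by (apply pow_nonzero; lra).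
  assert (H5 := INR_fact_neq_0 n).
  apply Rmult_integral_contrapositive_currified.
  - now repeat apply Rmult_integral_contrapositive_currified.
  - apply Rinv_neq_0_compat. nra.
Qed.

Lemma nrm_Ptil_nat n k t m : (k <= n)%nat -> (m = n + k \/ m = n - k)%nat ->
  nrm n m * Ptil_nat n k t = sqrt (1 - t ^ 2) ^ k * legc n t (n + k).
Proof.
  intros Hk Hm. unfold Ptil_nat, Pleg, nrm. rewrite legc_Derive by lia.
  assert (Hf : sqrt (INR (fact m) * INR (fact (2 * n - m)))
     = sqrt (INR (fact (n - k))) * sqrt (INR (fact (n + k)))).
  { rewrite <- sqrt_mult by apply pos_INR. f_equal. destruct Hm as [-> | ->].
    - replace (2 * n - (n + k))%nat with (n - k)%nat by lia. ring.
    - replace (2 * n - (n - k))%nat with (n + k)%nat by lia. ring. }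
  assert (Hs : (-1) ^ (n + m) = (-1) ^ k).
  { destruct Hm as [-> | ->].
    - rewrite Nat.add_assoc, !pow_add, pow_m1_sqr. ring.
    - replace (n + (n - k))%nat with ((n - k) + (n - k) + k)%nat by lia.
      rewrite !pow_add, pow_m1_sqr. ring. }
  rewrite Hf, Hs.
  assert (Hp := sqrt_normalisation_pos n). set (K := _ / _) in *.
  assert (H1 := INR_fact_lt_0 (n - k)). assert (H2 := INR_fact_lt_0 (n + k)).
  rewrite sqrt_mult by (try lra; apply Rlt_le, Rdiv_lt_0_compat; trivial).
  rewrite sqrt_div by lra.
  set (A := INR (fact (n - k))) in *. set (B := INR (fact (n + k))) in *.
  assert (HB : B = sqrt B * sqrt B) by (now rewrite sqrt_sqrt; [|lra]).
  (* The third occurrence is the factorial coming from the Taylor coefficient; split into two roots,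
     it cancels against the roots of both normalisations. *)
  rewrite HB at 3.
  transitivity (((-1) ^ k * (-1) ^ k) * sqrt (1 - t ^ 2) ^ k * legc n t (n + k));
    [|rewrite pow_m1_sqr; ring].
  assert (H4 := sqrt_lt_R0 _ H1). assert (H5 := sqrt_lt_R0 _ H2).
  assert (H6 := sqrt_lt_R0 _ Hp). assert (H7 := INR_fact_neq_0 n).
  assert (H8 : 2 ^ n <> 0) by (apply pow_nonzero; lra).
  field. repeat split; trivial; lra.
Qed.

Lemma Czpow_of_nat (u : C) k : Czpow u (Z.of_nat k) = (u ^ k)%C.
Proof. destruct k; [reflexivity|]. cbn [Z.of_nat Czpow]. now rewrite SuccNat2Pos.id_succ. Qed.

Lemma Czpow_opp_of_nat (u : C) k : Czpow u (- Z.of_nat k) = ((/ u) ^ k)%C.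
Proof.
  destruct k; [reflexivity|]. cbn [Z.of_nat Z.opp Czpow]. now rewrite SuccNat2Pos.id_succ.
Qed.

(** The factor [s ^ k], with [s] the sine of the polar angle, merges with the k-th power of [eiphi]
    or of its inverse into a power of [x + iy] or [x - iy]. *)
Lemma Ysh_harm n m (v : vec3) : (m <= 2 * n)%nat ->
  vx v ^ 2 + vy v ^ 2 + vz v ^ 2 = 1 ->
  (RtoC (nrm n m) * Ysh n (Z.of_nat m - Z.of_nat n) v)%C
  = harm n (vx v, vy v) (vx v, - vy v) (vz v) m.
Proof.
  intros Hm Hv. unfold Ysh, harm, Ptil.
  set (s := sqrt (1 - vz v ^ 2)).
  assert (Hr : sqrt (vx v ^ 2 + vy v ^ 2) = s) by (unfold s; f_equal; lra).
  assert (Hs2 : s * s = vx v ^ 2 + vy v ^ 2).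
  { rewrite <- Hr. apply sqrt_sqrt. nra. }
  (* This also holds at a pole, where [eiphi] is set to 1, because [s], [x] and [y] vanish there. *)
  assert (HX : (RtoC s * eiphi v)%C = (vx v, vy v) /\
               (RtoC s * / eiphi v)%C = (vx v, - vy v)).
  { unfold eiphi. cbv zeta. rewrite Hr. destruct (Req_EM_T s 0) as [H0|H0].
    - rewrite H0 in *. assert (vx v = 0 /\ vy v = 0) as [-> ->] by nra.
      rewrite !Cmult_0_l. split; [reflexivity|]. unfold RtoC. now rewrite Ropp_0.
    - split.
      + apply injective_projections; simpl; field; trivial.
      + assert (H1 : (vx v / s) ^ 2 + (vy v / s) ^ 2 = 1).
        { transitivity ((vx v ^ 2 + vy v ^ 2) / (s * s)); [now field|].
          rewrite <- Hs2. now field. }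
        unfold Cinv. simpl fst. simpl snd. rewrite H1.
        apply injective_projections; simpl; field; trivial. }
  destruct HX as [HX HY].
  destruct (Nat.leb_spec n m) as [H|H].
  - replace (Z.of_nat m - Z.of_nat n)%Z with (Z.of_nat (m - n)) by lia.
    rewrite (proj2 (Z.leb_le 0 _)), Nat2Z.id, Czpow_of_nat, Cmult_assoc, <- RtoC_mult by lia.
    rewrite (nrm_Ptil_nat n (m - n)) by lia. fold s.
    rewrite <- HX, Cpow_mult_l, RtoC_mult, RtoC_pow.
    replace (n + (m - n))%nat with m by lia. ring.
  - replace (Z.of_nat m - Z.of_nat n)%Z with (- Z.of_nat (n - m))%Z by lia.
    rewrite (proj2 (Z.leb_gt 0 _)), Z.opp_involutive, Nat2Z.id, Czpow_opp_of_nat by lia.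
    rewrite Cmult_assoc, <- RtoC_mult.
    replace (nrm n m * ((-1) ^ (n - m) * Ptil_nat n (n - m) (vz v)))
      with ((-1) ^ (n - m) * (nrm n m * Ptil_nat n (n - m) (vz v))) by ring.
    rewrite (nrm_Ptil_nat n (n - m)) by lia. fold s.
    replace (- (vx v, (- vy v)%R))%C with (RtoC (-1) * (RtoC s * / eiphi v))%C
      by (rewrite HY; apply injective_projections; simpl; ring).
    rewrite !Cpow_mult_l, !RtoC_mult, !RtoC_pow.
    replace (n + (n - m))%nat with (2 * n - m)%nat by lia. ring.
Qed.

Lemma Ysh_sum n (v : vec3) (u w : C) :
  vx v ^ 2 + vy v ^ 2 + vz v ^ 2 = 1 ->
  csum (fun m => RtoC (nrm n m) * Ysh n (Z.of_nat m - Z.of_nat n) v * u ^ m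
                 * w ^ (2 * n - m))%C (2 * n)
  = ((- (vx v, (- vy v)%R) * (w * w) + 2 * RtoC (vz v) * u * w + (vx v, vy v) * (u * u)) ^ n)%C.
Proof.
  intros Hv. rewrite <- (harm_sum n).
  - apply csum_ext. intros m Hm. now rewrite Ysh_harm.
  - apply injective_projections; simpl; [|ring].
    transitivity (vx v ^ 2 + vy v ^ 2); [ring|]. lra.
  - intros H. injection H as -> ->. unfold RtoC. now rewrite Ropp_0.
Qed.

(** * Wigner d-functions and the action of rotations *)

(** At [p = sqrt (1 + cos b)], [q = sqrt (1 - cos b)], which are [sqrt 2] times the cosine and sine
    of [b / 2], these are, up to scaling, the matrix entries of the rotation by [b] acting on binary
    forms of degree [2 * n]. *)
Definition wigc (n l : nat) (p q : R) : nat -> R := linprod p q l (- q) p (2 * n - l).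

Lemma wigc_rsum n l p q h : (l <= 2 * n)%nat ->
  rsum (fun m => wigc n l p q m * h ^ m) (2 * n)
  = (p + q * h) ^ l * (- q + p * h) ^ (2 * n - l).
Proof.
  intros Hl. rewrite <- linprod_rsum. now replace (l + (2 * n - l))%nat with (2 * n)%nat by lia.
Qed.

Lemma rsum_scal (a : R) (f : nat -> R) N : rsum (fun m => a * f m) N = a * rsum f N.
Proof. exact (sum_n_mult_l a f N). Qed.

Lemma rsum_switch (f : nat -> nat -> R) M N :
  rsum (fun i => rsum (fun j => f i j) N) M = rsum (fun j => rsum (fun i => f i j) M) N.
Proof. exact (sum_n_switch f M N). Qed.

(* Both sides, summed against [v^l w^m], give [(v (p + q w) + (p w - q))^(2n)],
   which is symmetric in [v] and [w]. *)
Lemma wigc_sym n l m p q : (l <= 2 * n)%nat -> (m <= 2 * n)%nat ->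
  Binomial.C (2 * n) l * wigc n l p q m = Binomial.C (2 * n) m * wigc n m p q l.
Proof.
  intros Hl Hm. set (B := Binomial.C (2 * n)).
  assert (E : forall v w : R,
    rsum (fun l => (B l * rsum (fun m => wigc n l p q m * w ^ m) (2 * n)) * v ^ l) (2 * n)
    = (v * (p + q * w) + (- q + p * w)) ^ (2 * n)).
  { intros v w. rewrite binomial, <- sum_n_Reals. apply rsum_ext. intros i Hi.
    rewrite wigc_rsum, Rpow_mult_distr by exact Hi. unfold B. ring. }
  apply (rpoly_coef_unique (fun m => B l * wigc n l p q m) (fun m => B m * wigc n m p q l)
           (2 * n)); [|exact Hm].
  intros w.
  transitivity (B l * rsum (fun m => wigc n l p q m * w ^ m) (2 * n)).
  { rewrite <- rsum_scal. apply rsum_ext. intros; ring. }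
  apply (rpoly_coef_unique
    (fun l => B l * rsum (fun m => wigc n l p q m * w ^ m) (2 * n))
    (fun l => rsum (fun m => B m * wigc n m p q l * w ^ m) (2 * n)) (2 * n)); [|exact Hl].
  intros v. rewrite E.
  replace (v * (p + q * w) + (- q + p * w)) with (w * (p + q * v) + (- q + p * v)) by ring.
  rewrite <- E.
  transitivity (rsum (fun m => rsum (fun l => B m * wigc n m p q l * w ^ m * v ^ l) (2 * n))
                  (2 * n)).
  - apply rsum_ext. intros i _.
    transitivity ((B i * w ^ i) * rsum (fun m => wigc n i p q m * v ^ m) (2 * n)); [ring|].
    rewrite <- rsum_scal. apply rsum_ext. intros; ring.
  - rewrite rsum_switch. apply rsum_ext. intros i _. rewrite Rmult_comm, <- rsum_scal.
    apply rsum_ext. intros; ring.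
Qed.

Lemma wigc_sym_fact n l m p q : (l <= 2 * n)%nat -> (m <= 2 * n)%nat ->
  wigc n l p q m * (INR (fact m) * INR (fact (2 * n - m)))
  = wigc n m p q l * (INR (fact l) * INR (fact (2 * n - l))).
Proof.
  intros Hl Hm. assert (H := wigc_sym n l m p q Hl Hm). unfold Binomial.C in H.
  assert (H1 := INR_fact_neq_0 l). assert (H2 := INR_fact_neq_0 m).
  assert (H3 := INR_fact_neq_0 (2 * n - l)). assert (H4 := INR_fact_neq_0 (2 * n - m)).
  assert (H5 := INR_fact_neq_0 (2 * n)).
  set (F := INR (fact (2 * n))) in *.
  set (a := INR (fact l)) in *. set (b := INR (fact m)) in *.
  set (c := INR (fact (2 * n - l))) in *. set (d := INR (fact (2 * n - m))) in *.
  apply (f_equal (fun x => x * (a * c) * (b * d) / F)) in H.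
  transitivity (F / (a * c) * wigc n l p q m * (a * c) * (b * d) / F); [now field|].
  rewrite H. now field.
Qed.

(* Rescaling the variable by [p q]. *)
Lemma linprod_wigc n l p q m : (l <= 2 * n)%nat -> (m <= 2 * n)%nat ->
  linprod (p * p) 1 l (q * q) (-1) (2 * n - l) m * (p * q) ^ m
  = (-1) ^ (2 * n - l) * (p ^ l * q ^ (2 * n - l)) * wigc n l p q m.
Proof.
  intros Hl Hm. set (e := linprod _ _ _ _ _ _). set (K := _ * (p ^ l * _)).
  apply (rpoly_coef_unique (fun m => e m * (p * q) ^ m) (fun m => K * wigc n l p q m) (2 * n));
    [|exact Hm].
  intros h. transitivity (rsum (fun m => e m * (p * q * h) ^ m) (l + (2 * n - l))).
  { replace (l + (2 * n - l))%nat with (2 * n)%nat by lia.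
    apply rsum_ext. intros i _. rewrite (Rpow_mult_distr (p * q)). ring. }
  unfold e. rewrite linprod_rsum.
  transitivity (K * rsum (fun m => wigc n l p q m * h ^ m) (2 * n)).
  - rewrite wigc_rsum by exact Hl. unfold K.
    replace (p * p + 1 * (p * q * h)) with (p * (p + q * h)) by ring.
    replace (q * q + -1 * (p * q * h)) with (-1 * q * (- q + p * h)) by ring.
    rewrite !Rpow_mult_distr. ring.
  - rewrite <- rsum_scal. apply rsum_ext. intros; ring.
Qed.

(** With [p * p = 1 + t] and [q * q = 1 - t], the powers of [1 + t] and [1 - t] under the root of
    [wd] are exactly those produced by the rescaling in [linprod_wigc]; the two signs
    [(-1) ^ (2 * n - l)] cancel. *)
Lemma wd_wigc n l m t : (l <= 2 * n)%nat -> (m <= 2 * n)%nat -> -1 < t < 1 ->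
  wd n (Z.of_nat n - Z.of_nat m) (Z.of_nat l - Z.of_nat n) t
  = / 2 ^ n * sqrt (INR (fact m) * INR (fact (2 * n - m))
                    / (INR (fact l) * INR (fact (2 * n - l))))
    * wigc n l (sqrt (1 + t)) (sqrt (1 - t)) m.
Proof.
  intros Hl Hm Ht. unfold wd, zfact.
  replace (Z.to_nat (Z.of_nat n - (Z.of_nat l - Z.of_nat n))) with (2 * n - l)%nat by lia.
  replace (Z.to_nat (Z.of_nat n + (Z.of_nat n - Z.of_nat m))) with (2 * n - m)%nat by lia.
  replace (Z.to_nat (Z.of_nat n + (Z.of_nat l - Z.of_nat n))) with l by lia.
  replace (Z.to_nat (Z.of_nat n - (Z.of_nat n - Z.of_nat m))) with m by lia.
  rewrite (Derive_n_linprod _ t (1 + t) 1 l (1 - t) (-1) (2 * n - l)); [| |lia].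
  2:{ intros h. f_equal; f_equal; ring. }
  set (p := sqrt (1 + t)). set (q := sqrt (1 - t)).
  assert (Hp : p * p = 1 + t) by (apply sqrt_sqrt; lra).
  assert (Hq : q * q = 1 - t) by (apply sqrt_sqrt; lra).
  assert (Hp0 : 0 < p) by (apply sqrt_lt_R0; lra).
  assert (Hq0 : 0 < q) by (apply sqrt_lt_R0; lra).
  assert (E := linprod_wigc n l p q m Hl Hm). rewrite Hp, Hq in E.
  set (e := linprod _ _ _ _ _ _ m) in *. set (w := wigc _ _ _ _ _) in *.
  set (a := INR (fact m)). set (b := INR (fact (2 * n - m))).
  set (c := INR (fact l)). set (d := INR (fact (2 * n - l))).
  assert (Ha : 0 < a) by apply INR_fact_lt_0. assert (Hb : 0 < b) by apply INR_fact_lt_0.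
  assert (Hc : 0 < c) by apply INR_fact_lt_0. assert (Hd : 0 < d) by apply INR_fact_lt_0.
  set (z1 := (_ - _ - (_ - _))%Z). set (z2 := (_ - _ + (_ - _))%Z).
  (* The exponents [z1] and [z2] may be negative, so they are completed to natural powers. *)
  assert (P1 : powerRZ (1 - t) z1 * (1 - t) ^ (2 * n - l) = (1 - t) ^ m).
  { rewrite !pow_powerRZ, <- powerRZ_add by lra. f_equal. unfold z1. lia. }
  assert (P2 : powerRZ (1 + t) z2 * (1 + t) ^ m = (1 + t) ^ l).
  { rewrite !pow_powerRZ, <- powerRZ_add by lra. f_equal. unfold z2. lia. }
  assert (Q1 : 0 < powerRZ (1 - t) z1) by (apply powerRZ_lt; lra).
  assert (Q2 : 0 < powerRZ (1 + t) z2) by (apply powerRZ_lt; lra).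
  set (W := _ / (d * c * _ * _)). set (V := a * b / _).
  assert (HW : 0 <= W).
  { apply Rlt_le, Rdiv_lt_0_compat; repeat apply Rmult_lt_0_compat; trivial. }
  assert (HV : 0 <= V).
  { apply Rlt_le, Rdiv_lt_0_compat; repeat apply Rmult_lt_0_compat; trivial. }
  set (S := p ^ l * q ^ (2 * n - l)) in *.
  assert (HS : 0 < S) by (apply Rmult_lt_0_compat; now apply pow_lt).
  (* Both sides are nonnegative, so comparing squares removes every root. *)
  assert (K : sqrt W * a * S = sqrt V * (p * q) ^ m).
  { apply Rsqr_inj.
    - apply Rmult_le_pos; [|lra]. apply Rmult_le_pos; [apply sqrt_pos|lra].
    - apply Rmult_le_pos; [apply sqrt_pos|]. apply pow_le, Rmult_le_pos; lra.
    - rewrite !Rsqr_mult, !Rsqr_sqrt by trivial.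
      replace (Rsqr S) with ((1 + t) ^ l * (1 - t) ^ (2 * n - l)).
      2:{ unfold S, Rsqr. rewrite <- Hp, <- Hq, !Rpow_mult_distr. ring. }
      replace (Rsqr ((p * q) ^ m)) with ((1 + t) ^ m * (1 - t) ^ m).
      2:{ unfold Rsqr. rewrite <- Hp, <- Hq, !Rpow_mult_distr. ring. }
      rewrite <- P1, <- P2. unfold W, V, Rsqr. field. repeat split; lra. }
  apply Rmult_eq_reg_r with S; [|lra].
  transitivity ((-1) ^ (2 * n - l) / 2 ^ n * e * (sqrt W * a * S)); [ring|].
  rewrite K.
  transitivity ((-1) ^ (2 * n - l) / 2 ^ n * sqrt V * (e * (p * q) ^ m)); [ring|].
  rewrite E.
  transitivity (((-1) ^ (2 * n - l) * (-1) ^ (2 * n - l)) * (/ 2 ^ n * sqrt V * w * S));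
    [unfold Rdiv; ring|].
  rewrite pow_m1_sqr. ring.
Qed.

Lemma cos_lt_1_abs x : sin x <> 0 -> -1 < cos x < 1.
Proof.
  intros H. assert (E := sin2_cos2 x). unfold Rsqr in E.
  assert (0 < sin x * sin x) by (destruct (Rdichotomy _ _ H); nra). nra.
Qed.

(** The right-hand side is continuous in [b], endpoints included, and equals the literal formula
    wherever the sine is nonzero; hence it is also the limit that defines [wd_beta] at 0 and
    [PI]. *)
Lemma wd_beta_wigc n l m b : (l <= 2 * n)%nat -> (m <= 2 * n)%nat -> 0 <= b <= PI ->
  wd_beta n (Z.of_nat n - Z.of_nat m) (Z.of_nat l - Z.of_nat n) b
  = / 2 ^ n * sqrt (INR (fact m) * INR (fact (2 * n - m))
                    / (INR (fact l) * INR (fact (2 * n - l))))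
    * wigc n l (sqrt (1 + cos b)) (sqrt (1 - cos b)) m.
Proof.
  intros Hl Hm Hb. unfold wd_beta.
  set (K := / 2 ^ n * _).
  set (g := fun x => K * wigc n l (sqrt (1 + cos x)) (sqrt (1 - cos x)) m).
  set (f := fun x => wd _ _ _ (cos x)).
  assert (Hfg : forall x, sin x <> 0 -> g x = f x).
  { intros x Hx. symmetry. apply wd_wigc; trivial. now apply cos_lt_1_abs. }
  (* [Lim] is two-sided, so agreement is needed on both sides of the endpoint, also outside the
     interval from 0 to [PI]. *)
  assert (Hlim : (forall y, Rabs y < 1 -> y <> 0 -> sin (b + y) <> 0) ->
                 real (Lim f b) = g b).
  { intros Hs. rewrite (is_lim_unique f b (g b)); [reflexivity|].
    apply (is_lim_ext_loc g).
    - exists posreal_one. intros y Hy Hyb. apply Hfg.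
      replace y with (b + (y - b)) by ring. apply Hs; [exact Hy|lra].
    - apply is_lim_continuity, continuity_pt_filterlim.
      assert (H1 : continuous (fun x => sqrt (1 + cos x)) b).
      { apply continuous_sqrt_comp. apply (continuous_plus (fun _ => 1) cos).
        - apply continuous_const.
        - apply continuous_cos. }
      assert (H2 : continuous (fun x => sqrt (1 - cos x)) b).
      { apply continuous_sqrt_comp. apply (continuous_minus (fun _ => 1) cos).
        - apply continuous_const.
        - apply continuous_cos. }
      apply (continuous_mult (fun _ => K)); [apply continuous_const|].
      apply linprod_continuous; trivial.
      apply (continuous_opp (fun x => sqrt (1 - cos x))); trivial. }
  assert (Hs1 : forall y, Rabs y < 1 -> y <> 0 -> sin y <> 0).
  { intros y Hy Hy0. assert (H2 := PI2_1). unfold Rabs in Hy.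
    destruct (Rcase_abs y) as [H|H].
    - assert (0 < sin (- y)) by (apply sin_gt_0; lra). rewrite sin_neg in H0. lra.
    - apply Rgt_not_eq, sin_gt_0; lra. }
  destruct (Rlt_dec 0 b) as [H0|H0]; [destruct (Rlt_dec b PI) as [H1|H1]|].
  - symmetry. apply Hfg. apply Rgt_not_eq, sin_gt_0; lra.
  - apply Hlim. intros y Hy Hy0. replace (b + y) with (y + PI) by lra.
    rewrite neg_sin. apply Ropp_neq_0_compat. now apply Hs1.
  - apply Hlim. intros y Hy Hy0. replace (b + y) with y by lra. now apply Hs1.
Qed.

(** [wigc_sym_fact] exchanges the two indices: [k] becomes the coefficient index, and the root of
    factorials in [wd_beta] turns [nrm n k] into [nrm n j]. Summing over [k] then yields a product
    of linear forms. *)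
Lemma nrm_wd_beta n j k b : (j <= 2 * n)%nat -> (k <= 2 * n)%nat -> 0 <= b <= PI ->
  nrm n k * wd_beta n (Z.of_nat j - Z.of_nat n) (Z.of_nat k - Z.of_nat n) b
  = nrm n j * / 2 ^ n * (-1) ^ (j + k)
    * wigc n (2 * n - j) (sqrt (1 + cos b)) (sqrt (1 - cos b)) k.
Proof.
  intros Hj Hk Hb.
  replace (Z.of_nat j - Z.of_nat n)%Z with (Z.of_nat n - Z.of_nat (2 * n - j))%Z by lia.
  rewrite wd_beta_wigc by (trivial; lia).
  set (p := sqrt (1 + _)). set (q := sqrt (1 - _)).
  assert (E := wigc_sym_fact n k (2 * n - j) p q Hk ltac:(lia)).
  replace (2 * n - (2 * n - j))%nat with j in * by lia. unfold nrm.
  set (w := wigc _ k _ _ _) in *. set (w' := wigc _ _ _ _ k) in *.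
  rewrite (Rmult_comm (INR (fact (2 * n - j)))) in *.
  assert (HA : 0 < INR (fact k) * INR (fact (2 * n - k)))
    by (apply Rmult_lt_0_compat; apply INR_fact_lt_0).
  assert (HB : 0 < INR (fact j) * INR (fact (2 * n - j)))
    by (apply Rmult_lt_0_compat; apply INR_fact_lt_0).
  set (A := INR (fact k) * _) in *. set (B := INR (fact j) * _) in *.
  rewrite (sqrt_div B A) by lra.
  assert (H1 := sqrt_lt_R0 _ HA). assert (H2 := sqrt_lt_R0 _ HB).
  assert (EA := sqrt_sqrt A (Rlt_le _ _ HA)). assert (EB := sqrt_sqrt B (Rlt_le _ _ HB)).
  assert (H3 := sqrt_lt_R0 _ (sqrt_normalisation_pos n)).
  set (sK := sqrt (_ / (4 * PI))) in *. set (sA := sqrt A) in *. set (sB := sqrt B) in *.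
  rewrite <- EA, <- EB in E.
  assert (Hw : w = w' * (sA * sA) / (sB * sB)).
  { rewrite <- E. field. lra. }
  rewrite Hw, !pow_add.
  transitivity ((-1) ^ n * (-1) ^ k * INR (fact n) / (sK * sB) * w').
  - field. repeat split; try lra. apply pow_nonzero; lra.
  - transitivity (((-1) ^ j * (-1) ^ j) * ((-1) ^ n * (-1) ^ k * INR (fact n) / (sK * sB) * w'));
      [rewrite pow_m1_sqr; ring|]. field. repeat split; try lra. apply pow_nonzero; lra.
Qed.

(** The generating function of the rotated point at [(h, 1)] is that of the original point at
    [(q + p * h, p - q * h)], divided by [2 ^ n]; the formula is the comparison of the coefficients
    of [h ^ k]. *)
Lemma Ysh_rot2 n k b th : (k <= 2 * n)%nat -> 0 <= b <= PI ->
  Ysh n (Z.of_nat k - Z.of_nat n) (rot2 (- b) (e_phi th))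
  = csum (fun j => Ysh n (Z.of_nat j - Z.of_nat n) (e_phi th)
      * RtoC (wd_beta n (Z.of_nat j - Z.of_nat n) (Z.of_nat k - Z.of_nat n) b))%C (2 * n).
Proof.
  intros Hk Hb. apply (Cmult_eq_reg_l (RtoC (nrm n k))).
  { intros H. apply RtoC_inj in H. now apply nrm_neq_0 in H. }
  set (y := fun j => Ysh n (Z.of_nat j - Z.of_nat n) (e_phi th)).
  set (p := sqrt (1 + cos b)). set (q := sqrt (1 - cos b)).
  assert (Hcb := COS_bound b).
  assert (Hp : p * p = 1 + cos b) by (apply sqrt_sqrt; lra).
  assert (Hq : q * q = 1 - cos b) by (apply sqrt_sqrt; lra).
  assert (Hpq : p * q = sin b).
  { unfold p, q. rewrite <- sqrt_mult by lra.
    rewrite <- (sqrt_Rsqr (sin b)) by (apply sin_ge_0; lra).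
    f_equal. rewrite sin2. unfold Rsqr. ring. }
  assert (Hth := sin2_cos2 th). assert (Hbb := sin2_cos2 b). unfold Rsqr in Hth, Hbb.
  apply (cpoly_coef_unique
    (fun k => RtoC (nrm n k) * Ysh n (Z.of_nat k - Z.of_nat n) (rot2 (- b) (e_phi th)))%C
    (fun k => RtoC (nrm n k) * csum (fun j => y j
      * RtoC (wd_beta n (Z.of_nat j - Z.of_nat n) (Z.of_nat k - Z.of_nat n) b)) (2 * n))%C
    (2 * n)); [|exact Hk]. clear k Hk.
  intros h.
  (* The sign [(-1) ^ (j + k)] is split: its part in [k] is absorbed by evaluating the Wigner
     polynomial at [- h]. *)
  transitivity (csum (fun k => csum (fun j => RtoC (/ 2 ^ n) * (-1) ^ j * RtoC (nrm n j) * y j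
      * (RtoC (wigc n (2 * n - j) p q k * (- h) ^ k)))%C (2 * n))%C (2 * n)).
  2:{ apply csum_ext. intros k Hk. rewrite <- csum_scal, Cmult_comm, <- csum_scal.
      apply csum_ext. intros j Hj.
      transitivity (y j * RtoC h ^ k * RtoC (nrm n k
        * wd_beta n (Z.of_nat j - Z.of_nat n) (Z.of_nat k - Z.of_nat n) b))%C;
        [|rewrite RtoC_mult; ring].
      rewrite nrm_wd_beta by trivial. fold p q.
      replace (- h) with (-1 * h) by ring.
      rewrite pow_add, Rpow_mult_distr, !RtoC_mult, !RtoC_pow. ring. }
  rewrite csum_switch.
  transitivity (RtoC (/ 2 ^ n) * csum (fun j => RtoC (nrm n j) * y j * RtoC (q + p * h) ^ j
     * RtoC (p - q * h) ^ (2 * n - j)) (2 * n))%C.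
  2:{ rewrite <- csum_scal. apply csum_ext. intros j Hj.
      rewrite csum_scal, <- rsum_RtoC, wigc_rsum by lia.
      replace (2 * n - (2 * n - j))%nat with j by lia.
      replace (- q + p * - h) with (-1 * (q + p * h)) by ring.
      replace (p + q * - h) with (p - q * h) by ring.
      rewrite Rpow_mult_distr, !RtoC_mult, !RtoC_pow.
      transitivity (RtoC ((-1) ^ j * (-1) ^ j) * (RtoC (/ 2 ^ n) * RtoC (nrm n j) * y j
         * RtoC (q + p * h) ^ j * RtoC (p - q * h) ^ (2 * n - j)))%C.
      - rewrite pow_m1_sqr. ring.
      - rewrite RtoC_mult, !RtoC_pow. ring. }
  unfold y. rewrite Ysh_sum by (unfold e_phi, vx, vy, vz; simpl; lra).
  transitivity (csum (fun m => RtoC (nrm n m)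
     * Ysh n (Z.of_nat m - Z.of_nat n) (rot2 (- b) (e_phi th)) * RtoC h ^ m
     * 1 ^ (2 * n - m))%C (2 * n)).
  { apply csum_ext. intros m _. rewrite Cpow_1_l. ring. }
  rewrite Ysh_sum.
  2:{ unfold rot2, e_phi, vx, vy, vz; simpl. rewrite cos_neg, sin_neg.
      transitivity (cos th * cos th * (sin b * sin b + cos b * cos b) + sin th * sin th);
        [ring|]. rewrite Hbb. lra. }
  rewrite <- pow_inv, RtoC_pow, <- Cpow_mult_l. f_equal.
  unfold rot2, e_phi, vx, vy, vz; simpl fst; simpl snd. rewrite cos_neg, sin_neg, <- Hpq.
  replace (cos b) with ((p * p - q * q) / 2) by lra.
  apply injective_projections; simpl.
  - field.
  (* The inserted factor equals 1 and makes both sides homogeneous of degree two in [p] and [q]. *)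
  - replace (sin th) with (sin th * ((p * p + q * q) / 2)) at 1 2 by (rewrite Hp, Hq; field).
    field.
Qed.

(** * Rotations about the third axis and the addition formula *)

Lemma cis_add x y : (cis x * cis y)%C = cis (x + y).
Proof.
  unfold cis. rewrite cos_plus, sin_plus. apply injective_projections; simpl; ring.
Qed.

Lemma cis_0 : cis 0 = RtoC 1.
Proof. unfold cis. now rewrite cos_0, sin_0. Qed.

Lemma cis_inv x : (/ cis x)%C = cis (- x).
Proof.
  assert (H : (cis (- x) * cis x)%C = RtoC 1).
  { rewrite cis_add, <- cis_0. f_equal. ring. }
  assert (Hx : cis x <> 0).
  { intros H0. rewrite H0, Cmult_0_r in H. symmetry in H. now apply C1_nz. }
  transitivity (cis (- x) * cis x * / cis x)%C; [rewrite H; ring|]. now field.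
Qed.

Lemma cis_pow x k : (cis x ^ k)%C = cis (INR k * x).
Proof.
  induction k as [|k IH].
  - change (cis x ^ 0)%C with (RtoC 1). rewrite <- cis_0. f_equal. simpl. ring.
  - rewrite Cpow_S, IH, cis_add, S_INR. f_equal. ring.
Qed.

Lemma Czpow_cis x j : Czpow (cis x) j = cis (IZR j * x).
Proof.
  destruct (Z.le_gt_cases 0 j) as [H|H].
  - rewrite <- (Z2Nat.id j H), Czpow_of_nat, cis_pow. now rewrite INR_IZR_INZ.
  - replace j with (- Z.of_nat (Z.to_nat (- j)))%Z at 1 by lia.
    rewrite Czpow_opp_of_nat, cis_inv, cis_pow, INR_IZR_INZ, Z2Nat.id by lia.
    f_equal. rewrite opp_IZR. ring.
Qed.

Lemma Ysh_e_phi n j th : Ysh n j (e_phi th) = (RtoC (Ptil n j 0) * cis (IZR j * th))%C.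
Proof.
  unfold Ysh. f_equal. rewrite <- Czpow_cis. f_equal. unfold eiphi, e_phi, vx, vy, cis.
  simpl fst. simpl snd. cbv zeta. replace (cos th ^ 2 + sin th ^ 2) with 1.
  - rewrite sqrt_1. destruct (Req_EM_T 1 0) as [H|_]; [lra|]. f_equal; field.
  - generalize (sin2_cos2 th). unfold Rsqr. intros E. rewrite <- E. ring.
Qed.

Lemma harm_cis n (X Y : C) z x m :
  harm n (X * cis x)%C (Y * cis (- x))%C z m
  = (harm n X Y z m * cis (IZR (Z.of_nat m - Z.of_nat n) * x))%C.
Proof.
  unfold harm. destruct (Nat.leb_spec n m) as [H|H].
  - rewrite Cpow_mult_l, cis_pow, INR_IZR_INZ, Nat2Z.inj_sub by lia. ring.
  - replace (- (Y * cis (- x)))%C with ((- Y) * cis (- x))%C by ring.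
    rewrite Cpow_mult_l, cis_pow, INR_IZR_INZ, Nat2Z.inj_sub by lia.
    rewrite !minus_IZR.
    replace ((IZR (Z.of_nat n) - IZR (Z.of_nat m)) * - x)
      with ((IZR (Z.of_nat m) - IZR (Z.of_nat n)) * x) by ring.
    ring.
Qed.

(** The rotation multiplies [x + iy] by [cis x] and [x - iy] by [cis (- x)]. Working with [harm] in
    place of [eiphi] treats the poles uniformly. *)
Lemma Ysh_rot3 n m x (v : vec3) : (m <= 2 * n)%nat ->
  vx v ^ 2 + vy v ^ 2 + vz v ^ 2 = 1 ->
  Ysh n (Z.of_nat m - Z.of_nat n) (rot3 x v)
  = (Ysh n (Z.of_nat m - Z.of_nat n) v * cis (IZR (Z.of_nat m - Z.of_nat n) * x))%C.
Proof.
  intros Hm Hv. apply (Cmult_eq_reg_l (RtoC (nrm n m))).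
  { intros H. apply RtoC_inj in H. now apply nrm_neq_0 in H. }
  rewrite Cmult_assoc, !Ysh_harm, <- harm_cis; trivial.
  - f_equal; unfold rot3, cis, vx, vy; rewrite ?cos_neg, ?sin_neg;
      apply injective_projections; simpl; ring.
  - unfold rot3. unfold vx at 1, vy at 2, vz at 1. simpl fst. simpl snd.
    generalize (sin2_cos2 x). unfold Rsqr. intros E.
    transitivity ((sin x * sin x + cos x * cos x) * (vx v ^ 2 + vy v ^ 2) + vz v ^ 2).
    + unfold vx, vy, vz. simpl. ring.
    + rewrite E. lra.
Qed.

(** The three Euler rotations act in turn: [a] shifts the equatorial angle to [phi - a], [b] mixes
    the orders by [Ysh_rot2], and [c] contributes a phase. *)
Lemma Ysh_Qinv n k a b c phi : (k <= 2 * n)%nat -> 0 <= b <= PI ->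
  Ysh n (Z.of_nat k - Z.of_nat n) (Qinv a b c (e_phi phi))
  = csum (fun i => let j := (Z.of_nat i - Z.of_nat n)%Z in
      RtoC (Ptil n j 0) * WD n j (Z.of_nat k - Z.of_nat n) a b c * cis (IZR j * phi))%C (2 * n).
Proof.
  intros Hk Hb. unfold Qinv.
  replace (rot3 (- a) (e_phi phi)) with (e_phi (phi - a)).
  2:{ unfold rot3, e_phi, vx, vy, vz. simpl. rewrite cos_minus, sin_minus, cos_neg, sin_neg.
      apply f_equal2; [apply f_equal2; ring|reflexivity]. }
  rewrite Ysh_rot3; [|exact Hk|].
  2:{ unfold rot2, e_phi, vx, vy, vz; simpl fst; simpl snd. rewrite cos_neg, sin_neg.
      generalize (sin2_cos2 b) (sin2_cos2 (phi - a)). unfold Rsqr. intros E1 E2.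
      transitivity (cos (phi - a) * cos (phi - a) * (sin b * sin b + cos b * cos b)
         + sin (phi - a) * sin (phi - a)); [ring|]. rewrite E1. lra. }
  rewrite Ysh_rot2, Cmult_comm, <- csum_scal by trivial.
  apply csum_ext. intros i _. cbv zeta. set (j := (Z.of_nat i - _)%Z). set (l := (_ - _)%Z).
  rewrite Ysh_e_phi. unfold WD.
  replace (IZR j * (phi - a)) with (- IZR j * a + IZR j * phi) by ring.
  rewrite <- cis_add. replace (IZR l * - c) with (- IZR l * c) by ring. ring.
Qed.

(** * The arc transform *)

Lemma is_RInt_cos_mul (j : Z) psi :
  is_RInt (fun x => cos (IZR j * x)) (- psi) psi (sfun j psi).
Proof.
  unfold sfun. destruct (Z.eqb_spec j 0) as [->|Hj].
  - replace (2 * psi) with (scal (psi - - psi) 1) by (unfold scal; simpl; unfold mult; simpl; ring).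
    apply (is_RInt_ext (fun _ => 1)).
    + intros x _. now rewrite Rmult_0_l, cos_0.
    + apply (is_RInt_const (V := R_NormedModule)).
  - assert (H : IZR j <> 0) by (now apply not_0_IZR).
    replace (2 * sin (IZR j * psi) / IZR j)
      with (minus (sin (IZR j * psi) / IZR j) (sin (IZR j * - psi) / IZR j)).
    + apply (is_RInt_derive (fun x => sin (IZR j * x) / IZR j)).
      * intros x _. auto_derive; [trivial|]. now field.
      * intros x _. apply continuous_comp; [|apply continuous_cos].
        apply (continuous_mult (fun _ => IZR j) (fun x => x));
          [apply continuous_const|apply continuous_id].
    + unfold minus, plus, opp. simpl.
      replace (IZR j * - psi) with (- (IZR j * psi)) by ring. rewrite sin_neg. now field.
Qed.

Lemma is_RInt_sin_mul (j : Z) psi :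
  is_RInt (fun x => sin (IZR j * x)) (- psi) psi 0.
Proof.
  destruct (Z.eqb_spec j 0) as [->|Hj].
  - assert (H : is_RInt (fun _ : R => 0) (- psi) psi ((psi - - psi) * 0))
      by exact (is_RInt_const (V := R_NormedModule) (- psi) psi 0).
    rewrite Rmult_0_r in H. apply (is_RInt_ext (fun _ => 0)); [|exact H].
    intros x _. now rewrite Rmult_0_l, sin_0.
  - assert (H : IZR j <> 0) by (now apply not_0_IZR).
    replace 0 with (minus (- cos (IZR j * psi) / IZR j) (- cos (IZR j * - psi) / IZR j)).
    + apply (is_RInt_derive (fun x => - cos (IZR j * x) / IZR j)).
      * intros x _. auto_derive; [trivial|]. now field.
      * intros x _. apply continuous_comp; [|apply continuous_sin].
        apply (continuous_mult (fun _ => IZR j) (fun x => x));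
          [apply continuous_const|apply continuous_id].
    + unfold minus, plus, opp. simpl.
      replace (IZR j * - psi) with (- (IZR j * psi)) by ring. rewrite cos_neg. now field.
Qed.

(** On an interval symmetric about 0 the sine part integrates to zero, so only the real factor
    [sfun] remains. *)
Lemma is_RInt_cis (z : C) (j : Z) psi :
  is_RInt (V := C_R_NormedModule) (fun x => (z * cis (IZR j * x))%C) (- psi) psi
    (z * RtoC (sfun j psi))%C.
Proof.
  assert (Hc := is_RInt_cos_mul j psi). assert (Hs := is_RInt_sin_mul j psi).
  replace (z * RtoC (sfun j psi))%C with
    (minus (scal (fst z) (sfun j psi)) (scal (snd z) 0),
     plus (scal (fst z) 0) (scal (snd z) (sfun j psi))).
  - apply (is_RInt_fct_extend_pair (U := R_NormedModule) (V := R_NormedModule)).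
    + apply (is_RInt_minus (V := R_NormedModule) (fun x => scal (fst z) (cos (IZR j * x)))
        (fun x => scal (snd z) (sin (IZR j * x)))); now apply (is_RInt_scal (V := R_NormedModule)).
    + apply (is_RInt_plus (V := R_NormedModule) (fun x => scal (fst z) (sin (IZR j * x)))
        (fun x => scal (snd z) (cos (IZR j * x)))); now apply (is_RInt_scal (V := R_NormedModule)).
  - unfold minus, plus, opp, scal. simpl. unfold mult. simpl.
    apply injective_projections; simpl; ring.
Qed.

Lemma is_RInt_csum (f : nat -> R -> C) (l : nat -> C) a b N :
  (forall i, is_RInt (V := C_R_NormedModule) (f i) a b (l i)) ->
  is_RInt (V := C_R_NormedModule) (fun x => csum (fun i => f i x) N) a b (csum l N).
Proof.
  intros H. induction N as [|N IH].
  - rewrite csum_0. apply (is_RInt_ext (V := C_R_NormedModule) (f O)); [|apply H].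
    intros x _. now rewrite csum_0.
  - rewrite csum_S.
    apply (is_RInt_ext (V := C_R_NormedModule) (fun x => csum (fun i => f i x) N + f (S N) x)%C).
    + intros x _. now rewrite csum_S.
    + now apply (is_RInt_plus (V := C_R_NormedModule) (fun x => csum (fun i => f i x) N) (f (S N))).
Qed.

(** * Values at the equator *)

Lemma csum_even (f : nat -> C) (h : C) n :
  csum (fun m => (if Nat.even m then f (Nat.div2 m) else RtoC 0) * h ^ m)%C (2 * n)
  = csum (fun l => f l * (h * h) ^ l)%C n.
Proof.
  induction n as [|n IH]; [reflexivity|].
  replace (2 * S n)%nat with (S (S (2 * n))) by lia.
  rewrite !csum_S, IH. replace (S (S (2 * n))) with (2 * S n)%nat by lia.
  rewrite Nat.even_even, Nat.div2_double.
  replace (S (2 * n)) with (2 * n + 1)%nat by lia.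
  rewrite Nat.even_odd, Cpow_mult_r. replace (h ^ 2)%C with (h * h)%C by (simpl; ring). ring.
Qed.

(** At the point [e_phi 0] the harmonics reduce to [Ptil n j 0] and the generating function to
    [(h * h - 1) ^ n]; the binomial theorem gives its coefficients, and the odd ones vanish. *)
Lemma nrm_Ptil_0 n m : (m <= 2 * n)%nat ->
  nrm n m * Ptil n (Z.of_nat m - Z.of_nat n) 0
  = if Nat.even m then Binomial.C n (Nat.div2 m) * (-1) ^ (n - Nat.div2 m) else 0.
Proof.
  intros Hm. apply RtoC_inj.
  set (f := fun l => RtoC (Binomial.C n l * (-1) ^ (n - l))).
  transitivity (if Nat.even m then f (Nat.div2 m) else RtoC 0);
    [|now destruct (Nat.even m)].
  apply (cpoly_coef_unique
    (fun m => RtoC (nrm n m * Ptil n (Z.of_nat m - Z.of_nat n) 0))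
    (fun m => if Nat.even m then f (Nat.div2 m) else RtoC 0) (2 * n)); [|exact Hm].
  intros h. rewrite csum_even.
  transitivity (csum (fun m => RtoC (nrm n m) * Ysh n (Z.of_nat m - Z.of_nat n) (e_phi 0)
     * RtoC h ^ m * 1 ^ (2 * n - m))%C (2 * n)).
  { apply csum_ext. intros i _. rewrite Ysh_e_phi, Cpow_1_l, Rmult_0_r, cis_0, RtoC_mult. ring. }
  rewrite Ysh_sum.
  2:{ unfold e_phi, vx, vy, vz; simpl. rewrite cos_0, sin_0. ring. }
  transitivity (RtoC ((h * h + -1) ^ n)).
  - rewrite RtoC_pow. f_equal. unfold e_phi, vx, vy, vz; simpl. rewrite cos_0, sin_0.
    apply injective_projections; simpl; ring.
  - rewrite binomial, <- sum_n_Reals.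
    etransitivity; [exact (rsum_RtoC _ n)|]. apply csum_ext. intros i _. unfold f.
    rewrite !RtoC_mult, !RtoC_pow, RtoC_mult. ring.
Qed.

Lemma dfact_nat_SS m : dfact_nat (S (S m)) = (S (S m) * dfact_nat m)%nat.
Proof. reflexivity. Qed.

Lemma dfact_nat_even l : INR (dfact_nat (2 * l)) = 2 ^ l * INR (fact l).
Proof.
  induction l as [|l IH]; [simpl; ring|].
  replace (2 * S l)%nat with (S (S (2 * l))) by lia.
  rewrite dfact_nat_SS, mult_INR, IH, fact_simpl, mult_INR, !S_INR, mult_INR. simpl. ring.
Qed.

Lemma dfact_nat_mul_pred m : (dfact_nat m * dfact_nat (m - 1))%nat = fact m.
Proof.
  (* At 0 the truncated predecessor is again 0, whose double factorial 1 agrees with the convention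
     for -1. *)
  destruct m as [|m]; [reflexivity|]. replace (S m - 1)%nat with m by lia.
  induction m as [|m IH]; [reflexivity|].
  rewrite dfact_nat_SS, fact_simpl, <- IH. ring.
Qed.

(** The factorials in [nrm] split into double factorials of even and odd arguments. The odd ones
    cancel, and the even ones multiply to [2 ^ n] times [l!(n - l)!], which matches the binomial
    coefficient. *)
Lemma Ptil_0_even n l : (l <= n)%nat ->
  Ptil n (Z.of_nat (2 * l) - Z.of_nat n) 0
  = (-1) ^ l * sqrt ((2 * INR n + 1) / (4 * PI)
       * (INR (dfact_nat (2 * (n - l) - 1)) * INR (dfact_nat (2 * l - 1))
          / (INR (dfact_nat (2 * (n - l))) * INR (dfact_nat (2 * l))))).
Proof.
  intros Hl. apply Rmult_eq_reg_l with (nrm n (2 * l)); [|apply nrm_neq_0].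
  rewrite nrm_Ptil_0 by lia. rewrite Nat.even_even, Nat.div2_double. unfold nrm.
  replace (2 * n - 2 * l)%nat with (2 * (n - l))%nat by lia.
  assert (Hpos : forall m, 0 < INR (dfact_nat m)).
  { intros m. apply lt_0_INR. assert (H := lt_O_fact m). rewrite <- dfact_nat_mul_pred in H. nia. }
  rewrite <- (dfact_nat_mul_pred (2 * l)), <- (dfact_nat_mul_pred (2 * (n - l))), !mult_INR.
  assert (E1 := dfact_nat_even l). assert (E2 := dfact_nat_even (n - l)).
  assert (P1 := Hpos (2 * l)%nat). assert (P2 := Hpos (2 * l - 1)%nat).
  assert (P3 := Hpos (2 * (n - l))%nat). assert (P4 := Hpos (2 * (n - l) - 1)%nat).
  set (e1 := INR (dfact_nat (2 * l))) in *. set (e2 := INR (dfact_nat (2 * (n - l)))) in *.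
  set (d1 := INR (dfact_nat (2 * l - 1))) in *. set (d2 := INR (dfact_nat (2 * (n - l) - 1))) in *.
  assert (Hp := sqrt_normalisation_pos n). set (K := _ / (4 * PI)) in *.
  assert (HD : 0 < d2 * d1) by nra. assert (HE : 0 < e2 * e1) by nra.
  replace (e1 * d1 * (e2 * d2)) with ((d2 * d1) * (e2 * e1)) by ring.
  rewrite (sqrt_mult K) by (try lra; apply Rlt_le, Rdiv_lt_0_compat; trivial).
  rewrite sqrt_div, sqrt_mult by lra.
  assert (S1 := sqrt_lt_R0 _ Hp). assert (S2 := sqrt_lt_R0 _ HD). assert (S3 := sqrt_lt_R0 _ HE).
  assert (S4 : sqrt (e2 * e1) * sqrt (e2 * e1) = 2 ^ n * (INR (fact l) * INR (fact (n - l)))).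
  { rewrite sqrt_sqrt, E1, E2 by lra. replace n with (l + (n - l))%nat at 3 by lia.
    rewrite pow_add. ring. }
  assert (F1 := INR_fact_lt_0 l). assert (F2 := INR_fact_lt_0 (n - l)).
  transitivity ((-1) ^ (n + 2 * l) * (-1) ^ l * (2 ^ n * INR (fact n))
      / (sqrt (e2 * e1) * sqrt (e2 * e1))).
  - rewrite S4. unfold Binomial.C.
    replace ((-1) ^ (n - l)) with ((-1) ^ (n + 2 * l) * (-1) ^ l).
    + field. repeat split; try lra. apply pow_nonzero; lra.
    (* The two exponents differ by [4 * l], so the signs agree. *)
    + rewrite <- pow_add. replace (n + 2 * l + l)%nat with ((n - l) + 2 * (2 * l))%nat by lia.
      rewrite pow_add, (pow_mult _ 2 (2 * l)). replace ((-1) ^ 2) with 1 by ring.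
      rewrite pow1. ring.
  - field. repeat split; lra.
Qed.

(** * Termwise integration and the two parities *)

Theorem theorem1 (n : nat) (k : Z)
  (hk : (- Z.of_nat n <= k <= Z.of_nat n)%Z) :
  (forall (a b c psi : R), 0 <= b <= PI -> 0 <= psi <= PI ->
     @eq C (arc (Ysh n k) a b c psi)
     (sum_n (G := C_AbelianMonoid)
       (fun i : nat =>
          let j := (Z.of_nat i - Z.of_nat n)%Z in
          (RtoC (Ptil n j 0) * WD n j k a b c * RtoC (sfun j psi))%C)
       (2 * n)%nat))
  /\
  (forall j : Z, (- Z.of_nat n <= j <= Z.of_nat n)%Z ->
     Ptil n j 0 =
     if Z.even (Z.of_nat n + j) then
       (-1) ^ (Z.to_nat ((Z.of_nat n + j) / 2))
       * sqrt ((2 * INR n + 1) / (4 * PI)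
               * (dfact (Z.of_nat n - j - 1) * dfact (Z.of_nat n + j - 1)
                  / (dfact (Z.of_nat n - j) * dfact (Z.of_nat n + j))))
     else 0).
Proof.
  split.
  - intros a b c psi Hb _. unfold arc.
    assert (Hk : exists m, (m <= 2 * n)%nat /\ k = (Z.of_nat m - Z.of_nat n)%Z).
    { exists (Z.to_nat (k + Z.of_nat n)). lia. }
    destruct Hk as (m & Hm & ->).
    apply (is_RInt_unique (V := C_R_CompleteNormedModule)).
    eapply (is_RInt_ext (V := C_R_NormedModule)).
    { intros phi _. symmetry. exact (Ysh_Qinv n m a b c phi Hm Hb). }
    apply (is_RInt_csum (fun i phi => let j := (Z.of_nat i - Z.of_nat n)%Z in
      RtoC (Ptil n j 0) * WD n j (Z.of_nat m - Z.of_nat n) a b c * cis (IZR j * phi))%C).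
    intros i. apply is_RInt_cis.
  - intros j Hj.
    assert (Hm : exists m, (m <= 2 * n)%nat /\ j = (Z.of_nat m - Z.of_nat n)%Z).
    { exists (Z.to_nat (j + Z.of_nat n)). lia. }
    destruct Hm as (m & Hm & ->).
    replace (Z.of_nat n + (Z.of_nat m - Z.of_nat n))%Z with (Z.of_nat m) by lia.
    destruct (Nat.Even_or_Odd m) as [[l ->]|[l ->]].
    + replace (Z.even (Z.of_nat (2 * l))) with true
        by (symmetry; rewrite Z.even_spec; exists (Z.of_nat l); lia).
      (* For [l = 0] or [l = n] an argument of [dfact] is -1; [Z.to_nat] sends it to 0, as does the
         truncated subtraction in [Ptil_0_even]. *)
      rewrite Ptil_0_even by lia. unfold dfact.
      repeat f_equal; try lia. rewrite Nat2Z.inj_mul, Z.mul_comm, Z.div_mul; lia.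
    + replace (Z.even (Z.of_nat (2 * l + 1))) with false.
      2:{ symmetry. rewrite <- Z.negb_odd. apply Bool.negb_false_iff, Z.odd_spec.
          exists (Z.of_nat l). lia. }
      apply Rmult_eq_reg_l with (nrm n (2 * l + 1)); [|apply nrm_neq_0].
      rewrite nrm_Ptil_0, Nat.even_odd by lia. ring.
Qed.
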